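(* Let $X$ be a shift and $(X_n)_{n\in\mathbb{N}}$ be its SFT cover. Let $Y$ be a shift that is a factor of $X$, and let $\varphi\colon X\to Y$ be a factor map. If there exist infinitely many $n\in\mathbb{N}$ such that $X_n=X_{n+\tau(n)}$ for the function $\tau(n)=2n+(1+n^n)\cdot n^{4n+1}$, then $Y$ has a characteristic measure.
   Context: A shift is a non-empty closed $\sigma$-invariant subset $X$ of $\mathcal{A}^{\mathbb{Z}}$, $\mathcal{A}$ a finite alphabet, where $(\sigma x)_n=x_{n+1}$. $\mathcal{F}(X)$ is the set of finite words over $\mathcal{A}$ occurring in no element of $X$. The SFT cover of $X$ is the sequence $(X_n)_{n\in\mathbb{N}}$, where $X_n$ is the shift of finite type consisting of all $x\in\mathcal{A}^{\mathbb{Z}}$ no subword of which is an element of $\mathcal{F}(X)$ of length at most $n$. A factor map $\varphi\colon X\to Y$ between shifts (possibly over different finite alphabets) is a continuous surjection with $\varphi\circ\sigma=\sigma\circ\varphi$. $\mathrm{Aut}(Y)$ is the group of homeomorphisms of $Y$ commuting with $\sigma$. A characteristic measure on $Y$ is a Borel probability measure on $Y$ invariant under every element of $\mathrm{Aut}(Y)$. *)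

(* Defs.v *)
From HB Require Import structures.
From mathcomp Require Import all_boot all_order all_algebra.
From mathcomp Require Import all_classical all_reals all_analysis.

Set Implicit Arguments.
Unset Strict Implicit.
Unset Printing Implicit Defensive.

Import GRing.Theory.

Local Open Scope classical_set_scope.
Local Open Scope ring_scope.

Definition full_shift (A : finType) : Type :=
  prod_topology (fun _ : int => discrete_topology A).

HB.instance Definition _ (A : finType) :=
  Topological.copy (full_shift A)
    (prod_topology (fun _ : int => discrete_topology A)).

Definition sigma (A : finType) (x : full_shift A) : full_shift A :=
  fun n : int => x (n + 1).
Arguments sigma {A} x.

(* Invariance is read two-sidedly, as [sigma X = X] and not as
   [sigma X `<=` X]; this makes [sigma] a homeomorphism of [X]. *)
Record shift_space (A : finType) := ShiftSpace {
  shift_set : set (full_shift A);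
  shift_set_neq0 : shift_set !=set0;
  shift_set_closed : closed shift_set;
  shift_set_sigma : sigma @` shift_set = shift_set
}.

Definition points (A : finType) (X : shift_space A) : Type :=
  set_type (shift_set X).

Coercion points : shift_space >-> Sortclass.

HB.instance Definition _ (A : finType) (X : shift_space A) :=
  Topological.copy (points X) (set_type (shift_set X)).

Fact points_inhabited (A : finType) (X : shift_space A) : exists x : X, True.
Proof. by case: (shift_set_neq0 X) => x /mem_set Xx; exists (exist _ x Xx). Qed.

(* The library only considers sigma-algebras on pointed types; the
   distinguished point, which exists since [X] is non-empty, plays no role. *)
HB.instance Definition _ (A : finType) (X : shift_space A) :=
  isPointed.Build (points X) (projT1 (cid (points_inhabited X))).

Fact shift_set_sigmaP (A : finType) (X : shift_space A) (x : full_shift A) :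
  shift_set X x -> shift_set X (sigma x).
Proof. by move=> Xx; rewrite -shift_set_sigma; exists x. Qed.

Definition sigma_points (A : finType) (X : shift_space A) (x : X) : X :=
  exist _ (sigma (set_val x)) (mem_set (shift_set_sigmaP (set_valP x))).
Arguments sigma_points {A X} x.

Definition subword (A : finType) (x : full_shift A) (i : int) (k : nat) :
    seq A :=
  [seq x (i + j%:Z) | j <- iota 0 k].

Definition occurs_in (A : finType) (w : seq A) (x : full_shift A) : Prop :=
  exists i : int, subword x i (size w) = w.

Definition forbidden (A : finType) (X : shift_space A) : set (seq A) :=
  [set w | forall x, shift_set X x -> ~ occurs_in w x].

Definition sft_cover (A : finType) (X : shift_space A) (n : nat) :
    set (full_shift A) :=
  [set x | forall w, occurs_in w x -> ~ (forbidden X w /\ (size w <= n)%N)].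

Definition factor_map (A B : finType) (X : shift_space A) (Y : shift_space B)
    (phi : X -> Y) : Prop :=
  [/\ continuous phi, set_surj setT setT phi
    & phi \o sigma_points =1 sigma_points \o phi].

Definition homeomorphism (S T : topologicalType) (f : S -> T) : Prop :=
  exists g : T -> S, [/\ cancel f g, cancel g f, continuous f & continuous g].

Definition Aut_shift (A : finType) (Y : shift_space A) : set (Y -> Y) :=
  [set f | homeomorphism f /\ f \o sigma_points =1 sigma_points \o f].
Arguments Aut_shift {A} Y _.

Notation borel Y := (g_sigma_algebraType (@open Y)).

Definition characteristic_measure (R : realType) (A : finType)
    (Y : shift_space A) (mu : probability (borel Y) R) : Prop :=
  forall f : Y -> Y, Aut_shift Y f ->
  forall B : set (borel Y), measurable B -> mu (f @^-1` B) = mu B.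

Definition tau (n : nat) : nat := (2 * n + (1 + n ^ n) * n ^ (4 * n + 1))%N.

(* Main.v *)
Require Import Defs.
From HB Require Import structures.
From mathcomp Require Import all_boot all_order all_algebra.
From mathcomp Require Import all_classical all_reals all_analysis.
From mathcomp Require Import zify.

(** Write phi as a sliding block code [slide l] of radius [r], and fix [n] with
    [X_n = X_(n + tau n)].  The measure on [Y] is a limit, along such [n], of
    uniform measures on finite sets of periodic points lying near [Y].

    A pigeonhole argument on the [#|A| ^ n] words of length [n] gives the subshift
    [X_n] a periodic point whose period [p] is at most [#|A| ^ n].  Let
    [P_n] be the set of the [z] with [z = shiftz p z] that are images under
    [slide l] of points of [X_n]; it is finite and non-empty.  Let [alpha] be an
    automorphism of [Y], given by a block code [a] of radius [s].  The code [a]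
    makes sense on all of [B^Z], and it maps [P_n] to itself.  Indeed, if [z] is in
    [P_n], then every window of [z] of length [n + tau n - 2 r] is a window of a
    point of [Y], so every window of [slide a z] of length [n + tau n - 2 r - 2 s]
    is a window of a point of [Y], that is of the image of a point [x] of [X].  A
    sofic shift is not determined by its short words, but a periodic point can be
    recognized: one window of length [p #|A| ^ n + r] is enough, because among
    the positions [0, p, 2 p, ..] of [x] two carry the same word of length [n],
    and repeating the stretch between them yields a point of [X_n] over
    [slide a z].  Since [p <= #|A| ^ n <= n ^ n], the value of [tau n] leaves enough
    room (lemmas [tau_large], [periodic_lift] and [slide_periodic_images]).
    The same applies to the inverse of [alpha], whence [a] permutes [P_n]
    ([slide_cancel]).

    Every [z] in [P_n] agrees with a point [rho z] of [Y] on a window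
    whose radius tends to infinity with [n].  The means [m_n D] of the indicator of [D] over the [rho z] are finitely
    additive on all subsets of [Y], and if membership in [D] depends on a fixed
    finite window, then [m_n] gives [D] and its preimage under [alpha] the same value
    once [n] is large.  A limit of [m_n] along an ultrafilter
    is finitely additive and invariant on such sets; by compactness of [Y] it is
    a premeasure on them, so it extends to a Borel probability measure
    ([additive_extension]), and this extension is invariant under all of [Aut(Y)]
    because the finite-window sets form a pi-system generating the
    Borel sets ([characteristic_window]). *)

Set Implicit Arguments.
Unset Strict Implicit.
Unset Printing Implicit Defensive.

Import Order.TTheory GRing.Theory Num.Theory.
Import numFieldNormedType.Exports.

Local Open Scope classical_set_scope.
Local Open Scope ring_scope.

(** * Windows and the topology of shift spaces *)

Definition agree (T : Type) (a b : int) (x y : int -> T) : Prop :=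
  forall j, a <= j < b -> x j = y j.

Lemma agreeC T a b (x y : int -> T) : agree a b x y -> agree a b y x.
Proof. by move=> h j /h. Qed.

Lemma agree_trans T a b (x y z : int -> T) :
  agree a b x y -> agree a b y z -> agree a b x z.
Proof. by move=> h h' j ab; rewrite h ?h'. Qed.

Lemma sub_agree T a b c d (x y : int -> T) :
  c <= a -> b <= d -> agree c d x y -> agree a b x y.
Proof. by move=> ca bd h j ab; apply: h; lia. Qed.

Definition agreeN (T : Type) (k : nat) (x y : int -> T) : Prop :=
  agree (- k%:Z) k%:Z x y.

Lemma sub_agreeN T k m (x y : int -> T) :
  (k <= m)%N -> agreeN m x y -> agreeN k x y.
Proof. by move=> km; apply: sub_agree; lia. Qed.

Section cylinders.
Variable A : finType.

Lemma full_shift_nbhsP (x : full_shift A) (U : set (full_shift A)) :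
  nbhs x U <-> exists k, forall x', agreeN k x x' -> U x'.
Proof.
split.
  pose F := filter_from [set: nat] (fun k => [set x' | agreeN k x x']).
  have FF : Filter F.
    apply: filter_from_filter; first by exists 0%N.
    move=> i j _ _; exists (maxn i j) => // x' h.
    by split; apply: sub_agreeN h; lia.
  have Fx : F --> (x : full_shift A).
    apply/cvg_sup => i; apply/cvg_image.
      by rewrite eqEsubset; split => // y _; exists (fun=> y).
    move=> V /= /nbhs_singleton Vx; exists [set x' | V (x' i)] => /=.
      exists `|i|.+1 => // x' h /=; rewrite -h //; lia.
    by rewrite eqEsubset; split => [_ /= [x' Vx' <-]|a Va]//; exists (fun=> a).
  by move=> /Fx[k _ kU]; exists k.
case=> k kU.
suff : nbhs x [set x' | agreeN k x x'] by apply: filterS.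
have cyl (j : int) : nbhs x [set x' : full_shift A | x' j = x j].
  have := @proj_continuous int (fun=> discrete_topology A) j x.
  by move=> /(_ _ (@discrete_set1 (discrete_topology A) (x j))).
elim: k {kU} => [|k IH].
  by apply: (@filterS _ (nbhs x) _ setT) => [x' _ j|]; [lia|exact: filterT].
apply: filterS (filterI (filterI (cyl k%:Z) (cyl (- k.+1%:Z))) IH).
move=> x' /= [[hk hNk] h] j jk.
have [hj|/orP[/eqP->|/eqP->]//] : (- k%:Z <= j < k%:Z) \/
    ((j == k%:Z) || (j == - k.+1%:Z)) by lia.
exact: h.
Qed.

Variable X : shift_space A.

Lemma points_nbhsP (x : X) (U : set X) :
  nbhs x U <-> exists k, forall x' : X, agreeN k (set_val x) (set_val x') -> U x'.
Proof.
split=> [[_ [[W oW <-] Wx WU]]|[k kU]].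
  have /full_shift_nbhsP[k kW] : nbhs (set_val x : full_shift A) W.
    exact: open_nbhs_nbhs.
  by exists k => x' /kW/WU.
have : nbhs x (set_val @^-1` [set x' | agreeN k (set_val x) x']).
  apply: (@initial_continuous X (full_shift A) set_val x).
  by apply/full_shift_nbhsP; exists k.
by apply: filterS.
Qed.

Lemma full_shift_compact : compact [set: full_shift A].
Proof.
have /tychonoff cA : forall i : int, compact [set: discrete_topology A].
  by move=> _; apply: finite_compact; exact: (@finite_finset A).
by rewrite (_ : [set: _] = [set f : full_shift A | forall i, [set: A] (f i)]) // eqEsubset.
Qed.

(** Compactness of [X], in the form of a cluster point of a sequence of points. *)
Lemma seq_cluster (u : nat -> X) : exists x : X, forall k N,
  exists2 m, (N <= m)%N & agreeN k (set_val x) (set_val (u m)).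
Proof.
have cX : compact (shift_set X : set (full_shift A)).
  by apply: subclosed_compact full_shift_compact _ => //; exact: shift_set_closed.
pose u_ n : full_shift A := set_val (u n).
have [|x [Xx clx]] := cX (u_ @ \oo) _.
  by exists 0%N => // n _; exact: set_valP.
exists (SigSub (mem_set Xx)) => k N.
have Fu : (u_ @ \oo) [set set_val (u m) | m in [set m | (N <= m)%N]].
  by exists N => // m /= Nm; exists m.
have nx : nbhs x [set x' | agreeN k x x'] by apply/full_shift_nbhsP; exists k.
have [y [[m /= Nm <-]]] := clx _ _ Fu nx.
by exists m.
Qed.

(** Uniform continuity of locally constant maps: if no window sufficed, pairs of
    points agreeing on ever larger windows with different values would
    accumulate at a point around which [F] is constant. *)
Lemma locally_constant_window (T : Type) (F : X -> T) :
  (forall x : X, exists k, forall x' : X,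
     agreeN k (set_val x) (set_val x') -> F x = F x') ->
  exists k, forall x x' : X, agreeN k (set_val x) (set_val x') -> F x = F x'.
Proof.
move=> locF; apply: contrapT => /forallNP noF.
have {noF} /choice[u uP] : forall k, exists xy : X * X,
    agreeN k (set_val xy.1) (set_val xy.2) /\ F xy.1 <> F xy.2.
  move=> k; move/existsNP: (noF k) => -[x /existsNP[x' /not_implyP[h h']]].
  by exists (x, x').
have [x clx] := seq_cluster (fun n => (u n).1).
have [k kF] := locF x.
have [m km xm] := clx k k; have [agr neq] := uP m.
apply: neq; rewrite -(kF _ xm); apply: kF; apply: agree_trans xm _.
exact: sub_agreeN agr.
Qed.

End cylinders.

(** * Sliding block codes *)

Definition shiftz (T : Type) (k : int) (x : int -> T) : int -> T :=
  fun n => x (n + k).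

Lemma shiftz0 T (x : int -> T) : shiftz 0 x = x.
Proof. by apply/funext => n; rewrite /shiftz addr0. Qed.

Lemma shiftzD T (k l : int) (x : int -> T) :
  shiftz (k + l) x = shiftz k (shiftz l x).
Proof. by apply/funext => n; rewrite /shiftz addrA. Qed.

Lemma shiftzK T (k : int) : cancel (@shiftz T k) (@shiftz T (- k)).
Proof. by move=> x; rewrite -shiftzD addNr shiftz0. Qed.

Lemma agree_shiftz T a b k (x y : int -> T) :
  agree (a + k) (b + k) x y -> agree a b (shiftz k x) (shiftz k y).
Proof. by move=> h j ab; apply: h; lia. Qed.

Section block_codes.
Variables (A : finType) (X : shift_space A).

Lemma point_inj : injective (set_val : X -> full_shift A).
Proof. exact: (@val_inj _ _ (set_type (shift_set X))). Qed.

(** Invariance under the inverse shift comes from [sigma @` X = X], not from mere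
    forward invariance. *)
Lemma shift_set_shiftz k (x : full_shift A) :
  shift_set X x -> shift_set X (shiftz k x).
Proof.
elim/int_ind: k x => [|k IH|k IH] x Xx; first by rewrite shiftz0.
  rewrite -addn1 PoszD addrC shiftzD.
  exact: (@shift_set_sigmaP _ _ (shiftz k x) (IH x Xx)).
have := IH x Xx; rewrite -{1}shift_set_sigma => -[y Xy yE].
rewrite (_ : shiftz _ x = y) //; apply/funext => n.
have /(congr1 (fun z : full_shift A => z (n - 1))) := yE.
by rewrite /sigma /shiftz subrK => ->; congr (x _); lia.
Qed.

Lemma commute_shiftz (B : finType) (Y : shift_space B) (F : X -> Y) :
  F \o sigma_points =1 sigma_points \o F ->
  forall k (x x' : X), set_val x' = shiftz k (set_val x) ->
  set_val (F x') = shiftz k (set_val (F x)).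
Proof.
move=> Fsigma.
have pos : forall (k : nat) (x x' : X), set_val x' = shiftz k%:Z (set_val x) ->
    set_val (F x') = shiftz k%:Z (set_val (F x)).
  elim=> [|k IH] x x' x'E.
    by rewrite shiftz0 in x'E; rewrite (point_inj x'E) shiftz0.
  pose x1 : X := SigSub (mem_set (shift_set_shiftz k%:Z (set_valP x))).
  have -> : x' = sigma_points x1.
    by apply: point_inj; rewrite [LHS]x'E -addn1 PoszD addrC shiftzD.
  have := congr1 set_val (Fsigma x1); rewrite /= => ->.
  by rewrite -addn1 PoszD addrC shiftzD -(IH x x1).
case=> [k|k] x x' x'E; first exact: pos.
move: x'E; rewrite NegzE => x'E.
by rewrite (pos k.+1 x' x) ?shiftzK // x'E -shiftzD subrr shiftz0.
Qed.

Definition slide (B : finType) (l : full_shift A -> B) (x : full_shift A) :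
  full_shift B := fun i => l (shiftz i x).

Definition window_rule (B : finType) (s : nat) (l : full_shift A -> B) : Prop :=
  forall x x', agreeN s x x' -> l x = l x'.

Lemma slide_shiftz (B : finType) (l : full_shift A -> B) k (x : full_shift A) :
  slide l (shiftz k x) = shiftz k (slide l x).
Proof. by apply/funext => i; rewrite /slide -shiftzD. Qed.

Lemma agree_slide (B : finType) s (l : full_shift A -> B) a b
    (x x' : full_shift A) : window_rule s l ->
  agree a b x x' -> agree (a + s%:Z) (b - s%:Z) (slide l x) (slide l x').
Proof.
move=> ls xx' j jab; apply: ls; apply: agree_shiftz.
by apply: sub_agree xx'; lia.
Qed.

Lemma window_ruleW (B : finType) s t (l : full_shift A -> B) :
  (s <= t)%N -> window_rule s l -> window_rule t l.
Proof. by move=> st ls x x' /(sub_agreeN st)/ls. Qed.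

(** The Curtis-Hedlund-Lyndon theorem.  The local rule is total, so that the code
    also acts on points outside [X], where [F] itself is meaningless. *)
Lemma block_code (B : finType) (Y : shift_space B) (F : X -> Y) :
  continuous F -> F \o sigma_points =1 sigma_points \o F ->
  exists s l, @window_rule B s l /\
    forall x : X, set_val (F x) = slide l (set_val x).
Proof.
move=> cF Fsigma.
have [|s sF] := @locally_constant_window A X B (fun x => set_val (F x) 0).
  move=> x.
  have : nbhs x (F @^-1` [set y | agreeN 1 (set_val (F x)) (set_val y)]).
    by apply: cF; apply/points_nbhsP; exists 1%N.
  by case/points_nbhsP => k kF; exists k => x' /kF; apply.
have [b0 _] := shift_set_neq0 Y.
pose l x := xget (b0 0)
  [set b | exists2 y : X, agreeN s x (set_val y) & set_val (F y) 0 = b].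
exists s, l; split=> [x x' xx'|x].
  congr xget; rewrite eqEsubset; split=> b [y xy yb]; exists y => //.
    exact: agree_trans (agreeC xx') xy.
  exact: agree_trans xx' xy.
apply/funext => i; rewrite /slide /l.
pose x1 : X := SigSub (mem_set (shift_set_shiftz i (set_valP x))).
have x1E : set_val (F x1) = shiftz i (set_val (F x)) by exact: commute_shiftz.
case: xgetP => [b _ [y xy <-]|/(_ (set_val (F x1) 0)) []]; last by exists x1.
by rewrite -(sF x1 y xy) x1E /shiftz add0r.
Qed.

End block_codes.

(** * Periodic points in the approximations of finite type *)

Lemma periodic_mul T (p : nat) (z : int -> T) (k : int) :
  shiftz p%:Z z = z -> shiftz (k * p%:Z) z = z.
Proof.
move=> zp; elim/int_ind: k => [|k IH|k IH]; first by rewrite mul0r shiftz0.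
  by rewrite -addn1 PoszD mulrDl mul1r shiftzD zp.
have zpN : shiftz (- p%:Z) z = z by rewrite -{1}zp shiftzK.
by rewrite -addn1 PoszD opprD mulrDl mulN1r shiftzD zpN.
Qed.

Lemma periodic_eq T (p : nat) (z : int -> T) (i j : int) :
  shiftz p%:Z z = z -> (p %| i - j)%Z -> z i = z j.
Proof.
move=> zp /dvdzP[k ijE].
have /(congr1 (fun f => f j)) := periodic_mul k zp.
by rewrite -ijE /shiftz addrC subrK.
Qed.

Section sft.
Variables (A : finType) (X : shift_space A).

(** By shift invariance a word of [X] can be found at any prescribed position, which
    turns the condition on forbidden words into one on windows. *)
Lemma sft_coverP n (x : full_shift A) : sft_cover X n x <->
  forall i, exists2 y, shift_set X y & agree i (i + n%:Z) x y.
Proof.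
split=> [Xx i|locx w [i iw] [Xw wn]].
  have : ~ forbidden X (subword x i n).
    move=> fw; apply: (Xx (subword x i n)).
      by exists i; rewrite size_map size_iota.
    by split; rewrite // size_map size_iota.
  rewrite /forbidden => /existsNP[y /not_implyP[Xy /contrapT[i']]].
  rewrite size_map size_iota => yE.
  exists (shiftz (i' - i) y); first exact: shift_set_shiftz.
  move=> j ij; have [m mE] : exists m : nat, j = i + m%:Z.
    by exists `|j - i|%N; lia.
  have mn : (m < n)%N by lia.
  move/(congr1 (fun s => nth (x i) s m)): yE.
  rewrite !(nth_map 0%N) ?size_iota // nth_iota // add0n mE => <-.
  by rewrite /shiftz; congr (y _); lia.
have [y Xy xy] := locx i; apply: (Xw y Xy); exists i; rewrite -{2}iw.
apply/eq_in_map => m; rewrite mem_iota add0n => mw.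
by apply/esym/xy; lia.
Qed.

(** Pigeonhole over the [#|A| ^ n + 1] words of length [n] at the positions
    [0, p, 2 p, ..]; spacing the positions by [p] makes [q] a multiple of [p]. *)
Lemma recurrent_window n p (x : full_shift A) : (0 < p)%N -> exists a q : nat,
  [/\ (0 < q)%N, (p %| a)%N, (p %| q)%N, (a + q <= p * #|A| ^ n)%N
    & forall v : nat, (v < n)%N -> x (a + v)%N%:Z = x (a + q + v)%N%:Z].
Proof.
move=> p_gt0.
pose w (t : 'I_(#|A| ^ n).+1) : {ffun 'I_n -> A} :=
  [ffun v : 'I_n => x (p * t + v)%N%:Z].
have /injectivePn[t [t' tt' ww']] : ~~ injectiveb w.
  apply/negP => /injectiveP/leq_card.
  by rewrite card_ffun !card_ord ltnn.
wlog lt_tt' : t t' tt' ww' / (t < t')%N.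
  move=> W; have : (t != t' :> nat) by [].
  rewrite neq_ltn => /orP[|] lt; first exact: (W t t').
  by apply: (W t' t) => //; rewrite eq_sym.
exists (p * t)%N, (p * (t' - t))%N; split.
- by rewrite muln_gt0 p_gt0 subn_gt0.
- exact: dvdn_mulr.
- exact: dvdn_mulr.
- by rewrite -mulnDr leq_mul2l subnKC ?(ltnW lt_tt') // -ltnS ltn_ord orbT.
move=> v vn; move/ffunP/(_ (Ordinal vn)): ww'.
by rewrite !ffunE -mulnDr subnKC // ltnW.
Qed.

(** Repeating forever the stretch of [x] between two occurrences of the same word of
    length [n] creates no new word of length [n]. *)
Lemma periodic_closing n p (x : full_shift A) : shift_set X x -> (0 < p)%N ->
  exists (a q : nat) (x' : full_shift A),
  [/\ (0 < q)%N, ((p %| a) && (p %| q))%N, (a + q <= p * #|A| ^ n)%N, shiftz q%:Z x' = x'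
   & forall i : int, agree 0 n%:Z (shiftz i x') (shiftz (a%:Z + (i %% q)%Z) x)].
Proof.
move=> Xx p_gt0; have [a [q [q_gt0 pa pq aq rec]]] := recurrent_window n x p_gt0.
(* The word of length [n + q] read at [a] has period [q]. *)
have per m : (m < n + q)%N -> x (a + m)%N%:Z = x (a + m %% q)%N%:Z.
  elim/ltn_ind: m => m IH mnq.
  have [mq|qm] := ltnP m q; first by rewrite modn_small.
  rewrite -(subnK qm) modnDr -IH; [|lia|lia].
  by rewrite [RHS]rec; [congr (x _)|]; lia.
exists a, q, (fun i => x (a%:Z + (i %% q)%Z)); split=> //.
  by rewrite pa pq.
  by apply/funext => i; rewrite /shiftz modzDr.
move=> i v; case: v => // v vn.
have [u [uE uq]] : exists u : nat, (i %% q)%Z = u%:Z /\ (u < q)%N.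
  exists `|(i %% q)%Z|%N; have := modz_ge0 i (d := q); have := ltz_mod i (d := q); lia.
rewrite /shiftz uE.
have -> : ((v%:Z + i) %% q)%Z = ((v + u) %% q)%N%:Z.
  by rewrite -modzDmr uE -modz_nat.
by rewrite -PoszD -per; [congr (x _)|]; lia.
Qed.

Lemma periodic_closing_cover n (x x' : full_shift A) (s : int -> int) :
  shift_set X x -> (forall i, agree 0 n%:Z (shiftz i x') (shiftz (s i) x)) ->
  sft_cover X n x'.
Proof.
move=> Xx agr; apply/sft_coverP => i.
exists (shiftz (s i - i) x); first exact: shift_set_shiftz.
move=> j ij; have := agr i (j - i); rewrite /shiftz subrK => ->; last lia.
by congr (x _); lia.
Qed.

Lemma sft_cover_periodic n : exists p (x : full_shift A),
  [/\ (0 < p <= #|A| ^ n)%N, shiftz p%:Z x = x & sft_cover X n x].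
Proof.
have [x Xx] := shift_set_neq0 X.
have [a [q [x' [q_gt0 _ aq x'q agr]]]] := periodic_closing n Xx (isT : (0 < 1)%N).
exists q, x'; split => //; first by rewrite q_gt0; lia.
exact: periodic_closing_cover agr.
Qed.

(** A periodic point is recognized as an image of [X_n] on a single long window:
    closing up [x] along a multiple [q] of the period [p] of [z] gives a point over
    [z] itself.  This is where periodicity compensates for the fact that the image of
    [X_n] is only a sofic shift. *)
Lemma periodic_lift (B : finType) (l : full_shift A -> B) r n p
    (x : full_shift A) (z : full_shift B) : window_rule r l -> (2 * r <= n)%N ->
  (0 < p)%N -> shiftz p%:Z z = z -> shift_set X x ->
  agree 0 (p * #|A| ^ n + r)%N%:Z (slide l x) z ->
  exists2 x', sft_cover X n x' & slide l x' = z.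
Proof.
move=> lr rn p_gt0 zp Xx xz.
have [a [q [x' [q_gt0 /andP[pa pq] aq x'q agr]]]] := periodic_closing n Xx p_gt0.
exists x'; first exact: periodic_closing_cover agr.
apply/funext => i.
(* [j] is the left end of the window of [x'] that determines the image at [i]. *)
pose j := i - r%:Z.
have jq0 := modz_ge0 j (d := q); have jq := ltz_mod j (d := q).
transitivity (slide l x (a%:Z + (j %% q)%Z + r%:Z)).
  apply: lr => v vr; have := agr j (v + r%:Z); rewrite /shiftz.
  rewrite (_ : v + r%:Z + j = v + i); last by rewrite /j; lia.
  by move=> ->; [congr (x _)|]; lia.
rewrite xz; last lia.
apply: periodic_eq zp _.
rewrite (_ : _ - i = a%:Z + (j %% q)%Z - j); last by rewrite /j; lia.
have -> : a%:Z + (j %% q)%Z - j = a%:Z - (j %/ q)%Z * q%:Z.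
  by rewrite {2}(divz_eq j q); lia.
by rewrite rpredB // dvdz_mull.
Qed.

End sft.

(** * Action of block codes on periodic images *)

Section periodic_images.
Variables (A B : finType) (X : shift_space A) (Y : shift_space B) (phi : X -> Y).
Variables (r : nat) (l : full_shift A -> B).
Hypotheses (l_rule : window_rule r l) (phiE : forall x, set_val (phi x) = slide l (set_val x)).

Definition periodic_images (n p : nat) : set (full_shift B) :=
  [set z | shiftz p%:Z z = z /\ exists2 x, sft_cover X n x & slide l x = z].

Lemma periodic_images_neq0 n : exists p,
  (0 < p <= #|A| ^ n)%N /\ periodic_images n p !=set0.
Proof.
have [p [x [pn xp Xx]]] := sft_cover_periodic X n.
exists p; split => //; exists (slide l x); split; last by exists x.
by rewrite -slide_shiftz xp.
Qed.

Lemma periodic_images_finite n p : (0 < p)%N -> finite_set (periodic_images n p).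
Proof.
case: p => // p _.
pose per (f : {ffun 'I_p.+1 -> B}) : full_shift B :=
  fun i => f (inord `|(i %% p.+1)%Z|%N).
apply: (@sub_finite_set _ _ (per @` setT)); last exact: finite_image.
move=> z [zp _]; exists [ffun j : 'I_p.+1 => z (j : nat)%:Z] => //.
apply/funext => i; rewrite /per ffunE; apply: (periodic_eq zp).
have i0 : (0 <= (i %% p.+1)%Z) by exact: modz_ge0.
have ip : ((i %% p.+1)%Z < p.+1%:Z) by exact: ltz_mod.
rewrite inordK; last by lia.
rewrite gez0_abs // {2}(divz_eq i p.+1) opprD addrCA subrr addr0 rpredN.
exact: dvdz_mull.
Qed.

(** Long windows of images of [X_M] are windows of points of [Y], although the
    images themselves need not belong to [Y]. *)
Lemma sft_image_shadow M z : (exists2 x, sft_cover X M x & slide l x = z) ->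
  forall (i : int) (L : nat), (L + 2 * r <= M)%N ->
  exists x : X, agree i (i + L%:Z) z (set_val (phi x)).
Proof.
move=> [x /sft_coverP Xx <-] i L LM; have [x0 Xx0 agr] := Xx (i - r%:Z).
exists (SigSub (mem_set Xx0)); rewrite phiE.
by apply: sub_agree (agree_slide l_rule agr); lia.
Qed.

(** The hypothesis on [N] is the room needed by [periodic_lift] after losing [r] on
    each side by passing to [Y] and [s] on each side by applying [a]. *)
Lemma slide_periodic_images (alpha : Y -> Y) s (a : full_shift B -> B) n N p z :
  set_surj setT setT phi -> window_rule s a ->
  (forall y, set_val (alpha y) = slide a (set_val y)) ->
  sft_cover X n = sft_cover X N ->
  (2 * r <= n)%N -> (0 < p)%N -> (p * #|A| ^ n + 3 * r + 2 * s <= N)%N ->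
  periodic_images n p z -> periodic_images n p (slide a z).
Proof.
move=> phi_surj a_rule alphaE XnN rn p_gt0 pN [zp zX]; rewrite XnN in zX.
have azp : shiftz p%:Z (slide a z) = slide a z by rewrite -slide_shiftz zp.
split => //.
(* The window of [z] starts at [- s], so that its image under [a] starts at [0]. *)
have [|x0 x0z] := sft_image_shadow zX (- s%:Z) (L := (p * #|A| ^ n + r + 2 * s)%N).
  by lia.
have [x1 _ x1E] := phi_surj (alpha (phi x0)) I.
apply: (@periodic_lift _ X _ l r n p (set_val x1)) => //; first exact: set_valP.
rewrite -phiE x1E alphaE.
by apply: sub_agree (agreeC (agree_slide a_rule x0z)); lia.
Qed.

(** On [Y] the codes [a] and [b] are inverse to each other, and the identity at one
    coordinate only involves a window that occurs in [Y]. *)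
Lemma slide_cancel (alpha beta : Y -> Y) s (a b : full_shift B -> B) N z :
  window_rule s a -> window_rule s b ->
  (forall y, set_val (alpha y) = slide a (set_val y)) ->
  (forall y, set_val (beta y) = slide b (set_val y)) ->
  cancel alpha beta -> (2 * r + 4 * s + 1 <= N)%N ->
  (exists2 x, sft_cover X N x & slide l x = z) -> slide b (slide a z) = z.
Proof.
move=> a_rule b_rule alphaE betaE ab rsN zX; apply/funext => i.
have [|x zx] := sft_image_shadow zX (i - (2 * s)%N%:Z) (L := (4 * s + 1)%N).
  by lia.
have /= := agree_slide b_rule (agree_slide a_rule zx).
rewrite -alphaE -betaE ab => -> //; last by lia.
by rewrite zx //; lia.
Qed.

End periodic_images.

(** * Extension of finitely additive set functions to Borel measures *)

Section window_sets.
Variables (A : finType) (Y : shift_space A).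

(** The clopen subsets of [Y]. *)
Definition window_set (D : set Y) : Prop :=
  exists k, forall y y' : Y, agreeN k (set_val y) (set_val y') -> D y -> D y'.

Lemma window_set0 : window_set set0.
Proof. by exists 0%N. Qed.

Lemma window_setC D : window_set D -> window_set (~` D).
Proof. by move=> [k kD]; exists k => y y' /agreeC yy' nDy /(kD _ _ yy'). Qed.

Lemma window_setU D E : window_set D -> window_set E -> window_set (D `|` E).
Proof.
move=> [k kD] [j jE]; exists (maxn k j) => y y' yy' [Dy|Ey]; [left|right].
  by apply: kD Dy; apply: sub_agreeN yy'; lia.
by apply: jE Ey; apply: sub_agreeN yy'; lia.
Qed.

Lemma window_setT : window_set setT.
Proof. by exists 0%N. Qed.

Lemma window_set_open D : window_set D -> open D.
Proof.
by move=> [k kD]; rewrite openE => y Dy; apply/points_nbhsP; exists k => y' /kD; apply.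
Qed.

(** The points whose window of radius [k] forces membership in [U] form the
    [k]-th term of the union. *)
Lemma open_bigcup_window (U : set Y) : open U ->
  exists2 D : nat -> set Y, (forall k, window_set (D k)) & U = \bigcup_k D k.
Proof.
rewrite openE => oU.
exists (fun k => [set y | forall y' : Y, agreeN k (set_val y) (set_val y') -> U y']).
  move=> k; exists k => y y' yy' h y'' y'y''.
  by apply: h; exact: agree_trans yy' y'y''.
rewrite eqEsubset; split=> [y /oU/points_nbhsP[k kU]|y [k _]]; first by exists k.
by apply.
Qed.

(** Countable additivity on finite-window sets is automatic: a cluster point of points
    escaping ever larger partial unions would lie in the union, hence in one of the
    [F i], together with points that have escaped it. *)
Lemma window_bigcup_finite (F : nat -> set Y) : (forall i, window_set (F i)) ->
  window_set (\bigcup_i F i) ->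
  exists N, \bigcup_i F i = \bigcup_(i in `I_N) F i.
Proof.
move=> Fw [k kF]; apply: contrapT => noN.
have /choice[u uP] : forall N, exists y, (\bigcup_i F i) y /\ ~ (\bigcup_(i in `I_N) F i) y.
  move=> N; apply: contrapT => /forallNP h; apply: noN; exists N.
  rewrite eqEsubset; split=> [y Fy|]; last exact: bigcup_subset.
  by apply: contrapT => nFy; apply: (h y).
have [y cly] := seq_cluster u.
have [m _ ym] := cly k 0%N.
have [i _ Fiy] := kF _ _ (agreeC ym) (uP m).1.
have [j jF] := Fw i; have [n ni yn] := cly j i.+1.
by apply: (uP n).2; exists i => //; exact: jF Fiy.
Qed.

End window_sets.

(** A copy of [Y] whose algebra of sets consists of the finite-window sets, so that
    Caratheodory extension applies to it. *)
Definition window_type (A : finType) (Y : shift_space A) : Type := points Y.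

HB.instance Definition _ (A : finType) (Y : shift_space A) :=
  Pointed.on (window_type Y).
HB.instance Definition _ (A : finType) (Y : shift_space A) :=
  @isAlgebraOfSets.Build default_measure_display (window_type Y)
   (@window_set A Y) (@window_set0 A Y) (@window_setU A Y) (@window_setC A Y).

Section extension.
Variables (R : realType) (A : finType) (Y : shift_space A) (m : set Y -> R).
Hypotheses (m_ge0 : forall D, 0 <= m D) (mT : m setT = 1)
  (mU : forall D E, D `&` E = set0 -> m (D `|` E) = m D + m E).

Let pm (D : set (window_type Y)) : \bar R := (m D)%:E.

Let m0 : m set0 = 0.
Proof.
have := mU (set0I (set0 : set Y)); rewrite set0U => h.
by apply: (addrI (m set0)); rewrite -h addr0.
Qed.

Let pm0 : pm set0 = 0%E. Proof. by rewrite /pm m0. Qed.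

Let pm_ge0 D : (0 <= pm D)%E. Proof. by rewrite lee_fin. Qed.

Let pm_sum (F : nat -> set Y) n : trivIset setT F ->
  (\sum_(0 <= i < n) pm (F i))%E = pm (\bigcup_(i in `I_n) F i).
Proof.
move=> tF; elim: n => [|n IH]; first by rewrite big_geq // II0 bigcup_set0 pm0.
rewrite big_nat_recr //= IH IIS bigcup_setU bigcup_set1 /pm mU //.
rewrite -subset0 => y [[i /= ilt Fiy] Fny].
move/trivIsetP: tF => /(_ i n I I); rewrite ltn_eqF // => /(_ isT) Fin.
have : (F i `&` F n) y by split; [exact: Fiy | exact: Fny].
by rewrite Fin.
Qed.

Let pm_sigma_additive : semi_sigma_additive pm.
Proof.
move=> F mF tF mUF; have [N FN] := window_bigcup_finite mF mUF.
apply: cvg_near_cst; exists N => // n /= Nn; rewrite pm_sum // FN.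
congr pm; rewrite eqEsubset; split; last first.
  by apply: bigcup_subset => i /= iN; exact: leq_trans Nn.
by rewrite -FN; exact: bigcup_subset.
Qed.

HB.instance Definition _ := isMeasure.Build _ (window_type Y) R pm
  pm0 pm_ge0 pm_sigma_additive.

Let borel_sub_window (D : set (borel Y)) : measurable D ->
  measurable (D : set (g_sigma_algebraType (@measurable _ (window_type Y)))).
Proof.
move: D; apply: smallest_sub => [|U oU].
  by apply: sigma_algebra_measurable.
have [D Dw ->] := open_bigcup_window oU.
apply: bigcupT_measurable => k.
by apply: (@sub_sigma_algebra _ setT (@measurable _ (window_type Y))); exact: Dw.
Qed.

Let mu (D : set (borel Y)) : \bar R := measure_extension pm D.

Let mu0 : mu set0 = 0%E. Proof. exact: measure0. Qed.

Let mu_ge0 D : (0 <= mu D)%E. Proof. exact: measure_ge0. Qed.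

Let mu_sigma_additive : semi_sigma_additive mu.
Proof.
move=> F mF tF mUF; apply: measure_semi_sigma_additive => //.
  by move=> i; exact: borel_sub_window.
exact: borel_sub_window.
Qed.

HB.instance Definition _ := isMeasure.Build _ (borel Y) R mu
  mu0 mu_ge0 mu_sigma_additive.

Let mu_window (D : set Y) : window_set D -> mu D = (m D)%:E.
Proof. by move=> Dw; rewrite /mu /measure_extension measurable_mu_extE. Qed.

Let mu_setT : mu setT = 1%E.
Proof. by rewrite mu_window ?mT//; exact: window_setT. Qed.

HB.instance Definition _ := Measure_isProbability.Build _ _ _ mu mu_setT.

(** Caratheodory extension of the restriction of [m] to the finite-window sets, on
    which compactness makes it a premeasure. *)
Lemma additive_extension : exists mu : probability (borel Y) R,
  forall D : set Y, window_set D -> mu D = (m D)%:E.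
Proof. by exists mu. Qed.

End extension.

(** * Characteristic measures as limits of almost invariant means *)

(** By compactness of the unit interval [f @ U] has a cluster point, and an ultrafilter
    converges to its cluster points. *)
Lemma ultra_lim (R : realType) (U : set_system nat) (f : nat -> R) :
  UltraFilter U -> (forall n, 0 <= f n <= 1) -> exists x : R, f @ U --> x.
Proof.
move=> UU f01.
have fU : (f @ U) `[0, 1]%classic.
  by apply: (@filterS _ U _ setT) => [n _ /=|]; [rewrite in_itv /= f01|exact: filterT].
have [x [_ clx]] := @segment_compact R 0 1 _ _ fU.
exists x => V Vx; have [//|/= nV] := in_ultra_setVsetC (f @^-1` V) UU.
by have [y []] := clx (~` V) V nV Vx.
Qed.

Section characteristic.
Variables (R : realType) (A : finType) (Y : shift_space A).

Lemma window_preimage (alpha : Y -> Y) D : Aut_shift Y alpha ->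
  window_set D -> window_set (alpha @^-1` D).
Proof.
move=> [[_ [_ _ calpha _]] alpha_sigma] [k kD].
have [s [a [a_rule alphaE]]] := block_code calpha alpha_sigma.
exists (k + s)%N => y y' yy' /=; apply: kD; rewrite !alphaE.
by apply: sub_agree (agree_slide a_rule yy'); lia.
Qed.

(** Two probability measures that agree on the pi-system of finite-window sets agree
    on the sigma-algebra it generates, which contains all open sets. *)
Lemma characteristic_window (mu : probability (borel Y) R) :
  (forall alpha, Aut_shift Y alpha -> forall D, window_set D ->
     mu (alpha @^-1` D) = mu D) -> characteristic_measure mu.
Proof.
move=> mu_inv alpha Aalpha D mD.
have m_alpha : measurable_fun setT (alpha : borel Y -> borel Y).
  apply: (@measurability _ _ (borel Y) (borel Y) setT alpha (@open Y)) => // _ [V oV <-].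
  rewrite setTI; apply: sub_sigma_algebra.
  by case: Aalpha => -[_ [_ _ /continuousP calpha _]] _; exact: calpha.
pose f : {mfun borel Y >-> borel Y} :=
  MeasurableFun.Pack (MeasurableFun.Class (isMeasurableFun.Build _ _ _ _ _ m_alpha)).
apply: (@g_sigma_algebra_measure_unique _ R (borel Y) (@window_set A Y) _
  (fun=> setT) _ _ (distribution mu f) mu).
- by move=> E Ew; apply: sub_sigma_algebra; exact: window_set_open.
- by move=> _; exact: window_setT.
- by rewrite bigcup_const //; exists 0%N.
- exact: (@measurableI _ (window_type Y)).
- by move=> E Ew; exact: mu_inv.
- by move=> _; rewrite [ltLHS](probability_setT (distribution mu f)) ltry.
move: D mD; apply: smallest_sub; first exact: smallest_sigma_algebra.
move=> E /open_bigcup_window[F Fw ->].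
apply: (@bigcupT_measurable _ (g_sigma_algebraType (@window_set A Y))) => k.
exact: sub_sigma_algebra.
Qed.

(** Limits along an ultrafilter exist for all sets at once and preserve finite
    additivity, while invariance for all but finitely many [n] becomes exact. *)
Theorem characteristic_of_asymptotic (m : nat -> set Y -> R) :
  (forall n D, 0 <= m n D) -> (forall n, m n setT = 1) ->
  (forall n D E, D `&` E = set0 -> m n (D `|` E) = m n D + m n E) ->
  (forall alpha, Aut_shift Y alpha -> forall D, window_set D ->
     \forall n \near \oo, m n (alpha @^-1` D) = m n D) ->
  exists mu : probability (borel Y) R, characteristic_measure mu.
Proof.
move=> m_ge0 mT mU m_inv.
have [U [UU ooU]] := ultraFilterLemma eventually_filter.
have m_le1 n D : 0 <= m n D <= 1.
  rewrite m_ge0 -(mT n) -(setUv D) mU ?setICr //.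
  by rewrite lerDl m_ge0.
have /choice[M Mlim] D : exists x : R, m ^~ D @ U --> x by exact: ultra_lim.
have Mlim_eq D x : m ^~ D @ U --> x -> M D = x.
  by move=> Dx; apply: (cvg_unique _ (Mlim D) Dx).
have [||D E DE|mu muE] := @additive_extension R A Y M.
- by move=> D; apply: (cvgr_to_ge (Mlim D)); exact: nearW.
- by apply: Mlim_eq; apply: cvg_near_cst; exact: nearW.
- apply: Mlim_eq; rewrite (_ : m ^~ _ = (m ^~ D) \+ (m ^~ E)).
    by apply: cvgD.
  by apply/funext => n; rewrite mU.
exists mu; apply: characteristic_window => alpha Aalpha D Dw.
rewrite !muE //; last exact: window_preimage.
congr (_%:E); apply: Mlim_eq; apply: cvg_trans (Mlim D).
by apply: near_eq_cvg; apply: ooU; near=> n; apply/esym; near: n; exact: m_inv.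
Unshelve. all: by end_near. Qed.

End characteristic.

(** * Uniform means over periodic images *)

(** With [c = #|A|]: the window length [p * c ^ n] required for lifting is at most
    [n ^ n * n ^ n], and the summand [2 n] of [tau n] absorbs the radii of the codes. *)
Lemma tau_large c n p : (0 < n)%N -> (c <= n)%N -> (p <= c ^ n)%N ->
  (p * c ^ n + 2 * n <= tau n)%N.
Proof.
move=> n_gt0 cn pc; rewrite /tau addnC leq_add2l.
have cnn : (c ^ n <= n ^ n)%N by rewrite leq_exp2r.
apply: leq_mul; first exact: leq_trans pc (leq_trans cnn (leqnSn _)).
by apply: leq_trans cnn _; rewrite leq_pexp2l //; lia.
Qed.

Lemma infinite_nat_ge (E : set nat) : infinite_set E ->
  forall k, exists n, (k <= n)%N /\ E n.
Proof.
move=> Einf k; apply: contrapT => /forallNP noE; apply: Einf.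
apply: (sub_finite_set _ (finite_II k)) => n En /=.
by rewrite ltnNge; apply/negP => kn; apply: (noE n).
Qed.

Section uniform_mean.
Variables (R : realType) (T : choiceType) (S : Type) (P : set T) (rho : T -> S).
Hypotheses (P_finite : finite_set P) (P_neq0 : P !=set0).

Definition uniform_mean (D : set S) : R :=
  (\sum_(z \in P) (\1_D (rho z) : R)) / (\sum_(z \in P) (1 : R)).

Let card_gt0 : 0 < \sum_(z \in P) (1 : R).
Proof.
rewrite fsbig_finite //= big_const_seq count_predT iter_addr_0 ltr0n.
rewrite lt0n size_eq0; apply/negP => /eqP P0.
have [z Pz] := P_neq0.
have : z \in finmap.enum_fset (fset_set P).
  by rewrite [_ \in _](in_fset_set P_finite) mem_set.
by rewrite P0.
Qed.

Lemma uniform_mean_ge0 D : 0 <= uniform_mean D.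
Proof.
apply: divr_ge0; last exact: ltW.
by rewrite fsbig_finite //; apply: sumr_ge0 => z _; rewrite indicE.
Qed.

Lemma uniform_meanT : uniform_mean setT = 1.
Proof.
rewrite /uniform_mean (eq_fsbigr (fun=> 1)) ?divff ?gt_eqF //.
by move=> z _; rewrite indicT.
Qed.

Lemma uniform_meanU D E : D `&` E = set0 ->
  uniform_mean (D `|` E) = uniform_mean D + uniform_mean E.
Proof.
move=> DE; rewrite /uniform_mean -mulrDl -fsbig_split //; congr (_ / _).
apply: eq_fsbigr => z _; rewrite !indicE in_setU.
have [zD|] := boolP (rho z \in D) => /=; last by rewrite add0r.
case: (boolP (rho z \in E)) => [zE|_]; last by rewrite addr0.
have : (D `&` E) (rho z) by split; exact: set_mem.
by rewrite DE.
Qed.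

Lemma uniform_mean_invariant (h : T -> T) D E : set_bij P P h ->
  (forall z, P z -> D (rho z) <-> E (rho (h z))) ->
  uniform_mean D = uniform_mean E.
Proof.
move=> hbij DE; rewrite /uniform_mean; congr (_ / _).
rewrite [RHS](reindex_fsbig h P P) //; apply: eq_fsbigr => z /set_mem Pz.
have DEz := DE z Pz; rewrite !indicE; congr (nat_of_bool _)%:R.
by apply/idP/idP => /set_mem zin; apply/mem_set; [exact: DEz.1|exact: DEz.2].
Qed.

End uniform_mean.

Theorem theorem4p6 (R : realType) (A B : finType) (X : shift_space A) (Y : shift_space B)
    (phi : X -> Y) (phi_factor : factor_map phi)
    (X_cover : infinite_set
       [set n : nat | sft_cover X n = sft_cover X (n + tau n)%N]) :
  exists mu : probability (borel Y) R, characteristic_measure mu.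
Proof.
case: phi_factor => cphi phi_surj phi_sigma.
have [r [l [l_rule phiE]]] := block_code cphi phi_sigma.
have /choice[N NP] := infinite_nat_ge X_cover.
have /choice[p pP] k := periodic_images_neq0 X l (N k).
pose P k := periodic_images X l (N k) (p k).
have p_gt0 k : (0 < p k)%N by case: (pP k) => /andP[].
have Pfin k : finite_set (P k) by exact: periodic_images_finite.
pose rho (k : nat) (z : full_shift B) : Y :=
  xget point [set y : Y | agreeN k z (set_val y)].
apply: (@characteristic_of_asymptotic R B Y
  (fun k => uniform_mean R (P k) (rho k))) => [k D|k|k D E|].
- by apply: uniform_mean_ge0 => //; case: (pP k).
- by apply: uniform_meanT => //; case: (pP k).
- by apply: uniform_meanU.
move=> alpha Aalpha D [w wD].
have [[beta [ab ba calpha cbeta]] alpha_sigma] := Aalpha.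
have beta_sigma : beta \o sigma_points =1 sigma_points \o beta.
  by move=> y; have := alpha_sigma (beta y); rewrite /= ba => <-; rewrite ab.
have [s1 [a [a_rule alphaE]]] := block_code calpha alpha_sigma.
have [s2 [b [b_rule betaE]]] := block_code cbeta beta_sigma.
pose s := maxn s1 s2.
have {}a_rule : window_rule s a by apply: window_ruleW a_rule; exact: leq_maxl.
have {}b_rule : window_rule s b by apply: window_ruleW b_rule; exact: leq_maxr.
(* [#|A|] serves [tau_large], [3 r + 4 s + 1] the windows lost to the codes, and
   [s + w] the comparison of [rho] before and after [a] on the window of [D]. *)
exists (#|A| + 3 * r + 4 * s + w + 1)%N => // k /= kK.
have [kN XN] := NP k.
have pbound : (p k * #|A| ^ N k + 2 * N k <= tau (N k))%N.
  have cN : (#|A| <= N k)%N.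
    by apply: leq_trans kN; apply: leq_trans kK; rewrite -!addnA leq_addr.
  by apply: tau_large => //; [lia|case: (pP k) => /andP[]].
have shadow z : P k z -> exists2 x, sft_cover X (N k + tau (N k)) x & slide l x = z.
  by rewrite -XN => -[].
have stable (gamma : Y -> Y) (g : full_shift B -> B) : window_rule s g ->
    (forall y, set_val (gamma y) = slide g (set_val y)) ->
    forall z, P k z -> P k (slide g z).
  move=> g_rule gammaE z.
  apply: (slide_periodic_images l_rule phiE phi_surj g_rule gammaE XN) => //; lia.
have bK z : P k z -> slide b (slide a z) = z.
  by move=> /shadow; apply: (slide_cancel l_rule phiE a_rule b_rule alphaE betaE ab); lia.
have aK z : P k z -> slide a (slide b z) = z.
  by move=> /shadow; apply: (slide_cancel l_rule phiE b_rule a_rule betaE alphaE ba); lia.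
have rhoP z : P k z -> agreeN k z (set_val (rho k z)).
  move=> /shadow zX; rewrite /rho; case: xgetP => // /(_ _) nrho.
  have [|x xz] := sft_image_shadow l_rule phiE zX (- k%:Z) (L := (2 * k)%N); first lia.
  by case: (nrho (phi x)); apply: sub_agree xz; lia.
apply: (@uniform_mean_invariant R _ _ (P k) (rho k) (slide a)).
  split.
  - by move=> z /(stable _ _ a_rule alphaE).
  - by move=> z z' /set_mem Pz /set_mem Pz' zz'; rewrite -(bK z) // zz' bK.
  - move=> z Pz; exists (slide b z); last exact: aK.
    exact: (stable _ _ b_rule betaE).
move=> z Pz /=.
have agr : agreeN w (set_val (alpha (rho k z))) (set_val (rho k (slide a z))).
  rewrite alphaE; apply: agree_trans.
    apply: agreeC; apply: sub_agree (agree_slide a_rule (rhoP z Pz)); lia.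
  apply: sub_agreeN (rhoP _ (stable _ _ a_rule alphaE z Pz)); lia.
by split; apply: wD => //; exact: agreeC.
Qed.
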